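(* For any odd prime $p$ and any positive integer $r$, $$\frac{1}{p^r}\sum_{k=0}^{(p^r-1)/2}(4k+1)\frac{(\frac12)_k^4}{(1)_k^4}\equiv \frac{1}{p}\sum_{k=0}^{(p-1)/2}(4k+1)\frac{(\frac12)_k^4}{(1)_k^4}\pmod{p^4}.$$
   Context: $(x)_k=x(x+1)\cdots(x+k-1)$ is the Pochhammer symbol, with $(x)_0=1$. A congruence $a\equiv b\pmod{p^m}$ between rational numbers means that $(a-b)/p^m$ is a rational number whose denominator is not divisible by $p$. *)

(* Defs.v *)
From mathcomp Require Import all_boot all_order all_algebra.
Set Implicit Arguments. Unset Strict Implicit. Unset Printing Implicit Defensive.
Import Order.TTheory GRing.Theory Num.Theory.
Local Open Scope ring_scope.

Definition pochhammer (x : rat) (k : nat) : rat :=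
  \prod_(i < k) (x + i%:R).

Definition rat_congr (p m : nat) (a b : rat) : Prop :=
  ~~ (p %| `|denq ((a - b) / (p%:R ^+ m))|)%N.

Definition S (n : nat) : rat :=
  (n%:R)^-1 * \sum_(0 <= k < (n.-1)./2.+1)
    ((4 * k + 1)%:R * (pochhammer (1/2) k) ^+ 4 / (pochhammer 1 k) ^+ 4).

(* Main.v *)
(** Write n = 2N+1, c_k = (1/2)_k / k! and x^[l] for x^((-1)^l).  By induction
on N, with a telescoping certificate,
  n S(n) = sum_(m odd, m <= n) 2 (n^2 / m) c_N^2 c_((n-m)/2) c_((n+m)/2),
and rewriting the c's as products of factors 1 +- n/l turns this into
  S(n) = sum_(m odd, m <= n) 2 n^2 / (m (n+m)) W(n,m),
  W(n,m) = wprod n m = prod_(l < m) (1 - n^2/l^2)^[l]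
    * prod_(m <= l < n) (1 - n/l)^(2[l]).
Now let n = p^(s+1) with s > 0.  All factors are 1 mod p, so W(n,m) is a p-adic
unit, and the terms with p not dividing m vanish mod n^2, hence mod p^4.  The
terms with p | m match those of S(n/p): the rational prefactor is homogeneous of
degree 0, and W(n,m) / W(n/p,m/p) is the subproduct over l prime to p.  There
n^2/l^2 vanishes mod p^4, and the reflection l -> n+m-l gives
  prod_(m < l < n) (1 - n/l)^(2[l]) = prod_(m < l < n) (1 - nm/(l(n+m-l)))^[l],
where nm vanishes mod p^3.  Replacing l by l+p changes a factor of the latter
product only mod p^4 and flips the sign [l], so consecutive blocks of length p,
of which there is an even number, cancel mod p^4. *)

Require Import Defs.
From mathcomp Require Import all_boot all_order all_algebra.
From mathcomp Require Import ring lra zify.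
Set Implicit Arguments. Unset Strict Implicit. Unset Printing Implicit Defensive.
Import Order.TTheory GRing.Theory Num.Theory.
Local Open Scope ring_scope.

(** * Rationals integral at p *)

(** Membership in the localization of Z at p; [rat_congr p m a b] unfolds to [pint] of (a - b) /
    p^m. *)
Definition pint (p : nat) (x : rat) : bool := ~~ (p %| `|denq x|)%N.

(** By Gauss's lemma the reduced denominator divides every d that clears x. Closure under sums and
    products then needs no reduced fractions. *)
Lemma pintP (p : nat) (x : rat) :
  reflect (exists2 d : nat, ~~ (p %| d)%N & x * d%:R \is a Num.int) (pint p x).
Proof.
apply: (iffP idP) => [px | [d pd /intrP[a xd]]].
  exists `|denq x|%N => //.
  by rewrite -[_%:R]/((Posz `|denq x|)%:~R) absz_denq -numqE intr_int.
apply: contra pd => /dvdn_trans; apply.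
have : numq x * d%:Z = a * denq x.
  apply: (@intr_inj rat); rewrite !intrM numqE -xd -[d%:~R]/(d%:R : rat); ring.
move=> /(congr1 absz); rewrite !abszM /= => e.
have := coprime_num_den x; rewrite coprime_sym => /Gauss_dvdr <-.
by rewrite e dvdn_mull.
Qed.

Lemma pint_int (p : nat) (x : rat) : prime p -> x \is a Num.int -> pint p x.
Proof.
move=> pp xi; apply/pintP; exists 1%N; last by rewrite mulr1.
by rewrite dvdn1; apply: contraL pp => /eqP ->.
Qed.

Lemma pint_nat (p n : nat) : prime p -> pint p n%:R.
Proof. by move=> pp; apply: pint_int => //; rewrite rpred_nat. Qed.

Lemma pintM (p : nat) (x y : rat) :
  prime p -> pint p x -> pint p y -> pint p (x * y).
Proof.
move=> pp /pintP[d pd xd] /pintP[e pe ye]; apply/pintP; exists (d * e)%N.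
  by rewrite Euclid_dvdM // negb_or pd pe.
by rewrite natrM mulrACA rpredM.
Qed.

Lemma pintD (p : nat) (x y : rat) :
  prime p -> pint p x -> pint p y -> pint p (x + y).
Proof.
move=> pp /pintP[d pd xd] /pintP[e pe ye]; apply/pintP; exists (d * e)%N.
  by rewrite Euclid_dvdM // negb_or pd pe.
rewrite natrM mulrDl [y * _]mulrCA !mulrA -mulrA rpredD //.
  by rewrite mulrA rpredM ?rpred_nat.
by rewrite -mulrA rpredM ?rpred_nat.
Qed.

Lemma pintN (p : nat) (x : rat) : pint p (- x) = pint p x.
Proof. by rewrite /pint denqN. Qed.

Lemma pintX (p k : nat) (x : rat) : prime p -> pint p x -> pint p (x ^+ k).
Proof.
move=> pp px; elim: k => [|k IH]; first by rewrite expr0 (pint_nat 1).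
by rewrite exprS pintM.
Qed.

Lemma pint_sum (p : nat) (I : eqType) (s : seq I) (P : pred I) (F : I -> rat) :
  prime p -> (forall i, i \in s -> P i -> pint p (F i)) ->
  pint p (\sum_(i <- s | P i) F i).
Proof.
move=> pp PF; rewrite big_seq_cond.
by elim/big_ind: _ => [|x y|i /andP[]]; [exact: (pint_nat 0)|exact: pintD|exact: PF].
Qed.

Lemma pint_natV (p l : nat) : ~~ (p %| l)%N -> pint p l%:R^-1.
Proof.
move=> pl; apply/pintP; exists l => //.
have [->|l0] := eqVneq l 0%N; first by rewrite mulr0 rpred0.
by rewrite mulVf ?pnatr_eq0 // rpred1.
Qed.

(** A positive l below p^(s+1) has p-adic valuation at most s. *)
Lemma pint_divp (p s l : nat) : prime p -> (0 < l < p ^ s.+1)%N ->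
  pint p ((p ^ s)%:R / l%:R).
Proof.
move=> pp /andP[l0 lp]; have [l' pl' le] := pfactor_coprime pp l0.
set v := logn p l in le; have p1 := prime_gt1 pp.
move: pl'; rewrite prime_coprime // => pl'.
have l'0 : (0 < l')%N by case: (l') pl' => //; rewrite dvdn0.
have vs : (v <= s)%N.
  by rewrite -ltnS -(ltn_exp2l _ _ p1) (leq_ltn_trans _ lp) // le leq_pmull.
have -> : (p ^ s)%:R / l%:R = (p ^ (s - v))%:R * l'%:R^-1 :> rat.
  rewrite -(subnK vs) addnK expnD le !natrM invfM [_^-1 * _]mulrC mulrA mulfK //.
  by rewrite pnatr_eq0 -lt0n expn_gt0 prime_gt0.
by rewrite pintM ?pint_nat ?pint_natV.
Qed.

(** * Congruence to 1 modulo p^k *)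

Definition onemod (p k : nat) (x : rat) : bool := pint p ((x - 1) / p%:R ^+ k).

Lemma onemod1 (p k : nat) : prime p -> onemod p k 1.
Proof. by move=> pp; rewrite /onemod subrr mul0r (pint_nat 0). Qed.

Lemma onemodP (p k : nat) (x : rat) : prime p ->
  reflect (exists2 y, pint p y & x = 1 + p%:R ^+ k * y) (onemod p k x).
Proof.
move=> pp; have p0 : p%:R ^+ k != 0 :> rat.
  by rewrite expf_neq0 // pnatr_eq0 -lt0n prime_gt0.
apply: (iffP idP) => [px | [y py ->]].
  by exists ((x - 1) / p%:R ^+ k) => //; rewrite [_ * (_ / _)]mulrC divfK // addrC subrK.
by rewrite /onemod addrAC subrr add0r mulrC mulKf.
Qed.

Lemma onemod_pint (p k : nat) (x : rat) : prime p -> onemod p k x -> pint p x.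
Proof.
move=> pp /(onemodP _ _ pp)[y py ->].
by rewrite pintD ?(pint_nat 1) // pintM // pintX // pint_nat.
Qed.

Lemma onemodW (p j k : nat) (x : rat) :
  prime p -> (j <= k)%N -> onemod p k x -> onemod p j x.
Proof.
move=> pp jk /(onemodP _ _ pp)[y py ->]; apply/(onemodP _ _ pp).
exists (p%:R ^+ (k - j) * y); first by rewrite pintM // pintX // pint_nat.
by rewrite mulrA -exprD subnKC.
Qed.

Lemma onemodM (p k : nat) (x y : rat) :
  prime p -> onemod p k x -> onemod p k y -> onemod p k (x * y).
Proof.
move=> pp ox oy; have px := onemod_pint pp ox.
have -> : x * y = x * (y - 1) + x by ring.
rewrite /onemod -addrA mulrDl -mulrA pintD // pintM //.
Qed.

(** With y = a/d, the number 1 + p y equals (d + p a) / d, and p does not divide d + p a because it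
    does not divide d. *)
Lemma onemod_unit (p : nat) (x : rat) :
  prime p -> onemod p 1 x -> x != 0 /\ pint p x^-1.
Proof.
move=> pp /(onemodP _ _ pp)[y /pintP[d pd /intrP[a ya]] ->].
have d0 : d%:R != 0 :> rat by rewrite pnatr_eq0; apply: contraNneq pd => ->.
pose e : int := d%:Z + p%:Z * a.
have pe : ~~ (p %| `|e|)%N.
  apply: contra pd => pe; suff : (p%:Z %| d%:Z)%Z by [].
  have -> : d%:Z = e - p%:Z * a by rewrite addrK.
  by apply: rpredB; [exact: pe | apply/dvdz_mulr/dvdzz].
have e0 : e%:~R != 0 :> rat.
  by rewrite intr_eq0; apply: contraNneq pe => ->.
have -> : 1 + p%:R ^+ 1 * y = e%:~R / d%:R.
  apply: (mulIf d0); rewrite divfK // /e intrD intrM -ya expr1.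
  by rewrite -[d%:~R]/(d%:R) -[p%:~R]/(p%:R); ring.
split; first by rewrite mulf_neq0 ?invr_eq0.
apply/pintP; exists `|e|%N => //.
rewrite invfM invrK -[`|e|%:R]/(`|e|%:Z%:~R).
have [e1|e1] := leP 0 e.
  by rewrite gez0_abs // mulrAC mulVf // mul1r rpred_nat.
by rewrite ltz0_abs // rmorphN mulrN mulrAC mulVf // mul1r rpredN rpred_nat.
Qed.

Lemma onemodV (p k : nat) (x : rat) :
  prime p -> (0 < k)%N -> onemod p k x -> onemod p k x^-1.
Proof.
move=> pp k0 ox; have [x0 px] := onemod_unit pp (onemodW pp k0 ox).
rewrite /onemod; have -> : x^-1 - 1 = - ((x - 1) * x^-1).
  by rewrite mulrBl divff // mul1r opprB.
by rewrite mulNr pintN mulrAC pintM.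
Qed.

Lemma onemod_prod (p k : nat) (I : eqType) (s : seq I) (P : pred I) (F : I -> rat) :
  prime p -> (forall i, i \in s -> P i -> onemod p k (F i)) ->
  onemod p k (\prod_(i <- s | P i) F i).
Proof.
move=> pp PF; rewrite big_seq_cond.
by elim/big_ind: _ => [|x y|i /andP[]]; [exact: onemod1|exact: onemodM|exact: PF].
Qed.

(** * Alternating products and cancellation of blocks *)

Definition alt (l : nat) (x : rat) : rat := if odd l then x^-1 else x.

Lemma altM (l : nat) (x y : rat) : alt l (x * y) = alt l x * alt l y.
Proof. by rewrite /alt; case: odd; rewrite ?invfM. Qed.

Lemma altX (l k : nat) (x : rat) : alt l (x ^+ k) = alt l x ^+ k.
Proof. by rewrite /alt; case: odd; rewrite ?exprVn. Qed.

Lemma onemod_alt (p k l : nat) (x : rat) :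
  prime p -> (0 < k)%N -> onemod p k x -> onemod p k (alt l x).
Proof. by rewrite /alt; case: odd => // pp k0; apply: onemodV. Qed.

(** Blocks of length p are removed two at a time. As p is odd, l and l + p have opposite parity, so
    their factors combine to X l / X (l + p) or its inverse. *)
Lemma onemod_alt_blocks (p k mu t : nat) (X : nat -> rat) :
  prime p -> odd p -> (0 < k)%N ->
  (forall l, (p * mu <= l)%N -> (l + p < p * (mu + t.*2))%N -> ~~ (p %| l)%N ->
     onemod p k (X l / X (l + p)%N)) ->
  onemod p k (\prod_(p * mu <= l < p * (mu + t.*2) | ~~ (p %| l)%N) alt l (X l)).
Proof.
move=> pp op k0; elim: t => [|t IH] HX.
  by rewrite addn0 big_geq // onemod1.
have e : (p * (mu + t.+1.*2) = p * (mu + t.*2) + p + p)%N.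
  by rewrite doubleS !addnS !mulnS; lia.
rewrite e in HX *; set A := (p * (mu + t.*2))%N in IH e HX *.
have mA : (p * mu <= A)%N by rewrite leq_mul2l leq_addr orbT.
have pA : (p %| A)%N by rewrite dvdn_mulr.
rewrite (@big_cat_nat _ _ _ A) /=; [|lia|lia].
apply: onemodM => //; first by apply: IH => l l1 l2; apply: HX => //; lia.
rewrite (@big_cat_nat _ _ _ (A + p)) /=; [|lia|lia].
(* The second block is translated by p onto the first; this preserves divisibility by p. *)
rewrite [X in _ * X]big_addn addnK.
under [X in _ * X]eq_bigl => l do rewrite dvdn_addl //.
rewrite -big_split; apply: onemod_prod => // l.
rewrite mem_index_iota /= => /andP[l1 l2] pl.
have -> : alt l (X l) * alt (l + p) (X (l + p)%N) = alt l (X l / X (l + p)%N).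
  by rewrite /alt oddD op addbT; case: (odd l); rewrite /= ?invfM ?invrK.
by apply: onemod_alt => //; apply: HX => //; lia.
Qed.

(** * Reindexing over the multiples of p *)

Lemma big_dvdn (T : Type) (idx : T) (op : Monoid.com_law idx) (p n : nat)
  (P : pred nat) (F : nat -> T) : (0 < p)%N ->
  \big[op/idx]_(0 <= l < p * n | (p %| l)%N && P l) F l =
  \big[op/idx]_(0 <= i < n | P (p * i)%N) F (p * i)%N.
Proof.
move=> p0; elim: n => [|n IH]; first by rewrite muln0 !big_geq.
rewrite big_mkcond [RHS]big_mkcond /=.
rewrite (@big_cat_nat _ _ _ (p * n)) /=; [|lia|lia].
rewrite -big_mkcond IH big_mkcond -[RHS]big_mkcond /=.
rewrite [RHS]big_mkcond big_nat_recr //=; congr (op _ _).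
(* In the last block only its first index p n is a multiple of p. *)
rewrite mulnS addnC big_ltn; last lia.
rewrite dvdn_mulr //= big1_seq ?Monoid.mulm1 // => i.
rewrite mem_index_iota => /andP[i1 i2].
case: ifP => // /andP[/dvdnP[q iq]] _; move: i1 i2.
rewrite iq mulnC ltn_pmul2r // -mulSnr ltn_pmul2r // ltnS => nq qn.
by exfalso; lia.
Qed.

Lemma big_dvdnS (T : Type) (idx : T) (op : Monoid.com_law idx) (p n : nat)
  (P : pred nat) (F : nat -> T) : (0 < p)%N ->
  \big[op/idx]_(0 <= l < (p * n).+1 | (p %| l)%N && P l) F l =
  \big[op/idx]_(0 <= i < n.+1 | P (p * i)%N) F (p * i)%N.
Proof.
move=> p0; rewrite big_mkcond [RHS]big_mkcond !big_nat_recr //= dvdn_mulr //=.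
by rewrite -!big_mkcond big_dvdn.
Qed.

(** * The transformed sum *)

(** This is binom(2k,k) / 4^k. *)
Definition cbin (k : nat) : rat := pochhammer (1/2) k / pochhammer 1 k.

Lemma cbin0 : cbin 0 = 1.
Proof. by rewrite /cbin /pochhammer !big_ord0 divr1. Qed.

Lemma cbinS (k : nat) : cbin k.+1 = cbin k * ((2 * k%:R + 1) / (2 * k%:R + 2)).
Proof.
rewrite /cbin /pochhammer !big_ord_recr /= !invfM.
have k0 : 0 <= k%:R :> rat by exact: ler0n.
have pp : \prod_(i < k) (1 + i%:R) != 0 :> rat.
  by apply/prodf_neq0 => i _; rewrite nat1r pnatr_eq0.
field; rewrite pp; do ?[apply/andP; split]; rewrite ?nat1r ?pnatr_eq0 //.
by apply: lt0r_neq0; lra.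
Qed.

Lemma cbin_neq0 (k : nat) : cbin k != 0.
Proof.
elim: k => [|k IH]; first by rewrite cbin0.
have k0 : 0 <= k%:R :> rat by exact: ler0n.
rewrite cbinS; apply: mulf_neq0 => //; apply: lt0r_neq0.
by apply: divr_gt0; lra.
Qed.

(* The summation index i stands for m = 2i+1. *)
Definition vterm (N i : nat) : rat :=
  2 * (2 * N%:R + 1) ^+ 2 * cbin N ^+ 2 * cbin (N - i) * cbin (N.+1 + i)
  / (2 * i%:R + 1).

(* The certificate g(i) = c_(N+1-i) c_(N+1+i) makes the N-difference of vterm
   telescope in i. *)
Lemma vterm_succ (N i : nat) : (i <= N)%N ->
  vterm N.+1 i = vterm N i
    - (4 * N%:R + 5) * cbin N.+1 ^+ 2
      * (cbin (N.+1 - i.+1) * cbin (N.+1 + i.+1) - cbin (N.+1 - i) * cbin (N.+1 + i)).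
Proof.
move=> iN; have [j {iN}->] : exists j, N = (j + i)%N.
  by exists (N - i)%N; rewrite subnK.
rewrite /vterm subSS subSn ?leq_addl // addnK !addSn addnS !cbinS.
have -> : (j + i).+1%:R = j%:R + i%:R + 1 :> rat by rewrite -natr1 natrD.
have -> : ((j + i).+1 + i)%:R = j%:R + i%:R + 1 + i%:R :> rat.
  by rewrite natrD -natr1 natrD.
rewrite natrD.
have i0 : 0 <= i%:R :> rat by exact: ler0n.
have j0 : 0 <= j%:R :> rat by exact: ler0n.
by field; do ?[apply/andP; split]; apply: lt0r_neq0; lra.
Qed.

Lemma sum_cbin4 (N : nat) :
  \sum_(0 <= k < N.+1) (4 * k + 1)%:R * cbin k ^+ 4 =
  \sum_(0 <= i < N.+1) vterm N i.
Proof.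
elim: N => [|N IH].
  rewrite !big_nat1 /vterm !cbinS cbin0 /=; by field.
rewrite big_nat_recr // IH [RHS]big_nat_recr //=.
rewrite [in RHS](eq_big_nat _ _ (F2 := fun i => vterm N i
    - (4 * N%:R + 5) * cbin N.+1 ^+ 2
      * (cbin (N.+1 - i.+1) * cbin (N.+1 + i.+1) - cbin (N.+1 - i) * cbin (N.+1 + i))));
  last by move=> i /andP[_ iN]; apply: vterm_succ.
rewrite sumrB -mulr_sumr telescope_sumr //.
(* The new term [vterm N.+1 N.+1] cancels the boundary value g(N+1), since c_(2N+3) = c_(2N+2)
   (4N+5)/(4N+6). The other boundary value g(0) = c_(N+1)^2 gives the new summand on the left. *)
rewrite /vterm subnn subn0 addn0 addSn !cbinS cbin0 natrD natrM -[N.+1%:R]natr1.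
rewrite -[(N + N.+1).+1%:R]natr1 natrD -[N.+1%:R]natr1.
have N0 : 0 <= N%:R :> rat by exact: ler0n.
by field; do ?[apply/andP; split]; apply: lt0r_neq0; lra.
Qed.

(** * The product W(n,m) *)

Definition wprod (n m : nat) : rat :=
  \prod_(1 <= l < n)
    alt l (if (l < m)%N then 1 - (n%:R / l%:R) ^+ 2 else (1 - n%:R / l%:R) ^+ 2).

(** Uses 1 - x^2 = (1 - x)^2 (1 + x)/(1 - x) with x = n/l, where l < m <= n excludes x = 1. Only the
    second product depends on m, which prepares an induction on m. *)
Lemma wprod_split (n m : nat) : (m <= n)%N ->
  wprod n m = \prod_(1 <= l < n) alt l (1 - n%:R / l%:R) ^+ 2
    * \prod_(1 <= l < m) alt l ((1 + n%:R / l%:R) / (1 - n%:R / l%:R)).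
Proof.
move=> mn; rewrite /wprod.
have [->|m0] := posnP m.
  by rewrite [X in _ * X]big_geq // mulr1; apply: eq_bigr => l _; rewrite altX.
rewrite [LHS](big_cat_nat m0 mn) [in RHS](big_cat_nat m0 mn) /= mulrAC.
congr (_ * _); last first.
  apply: eq_big_nat => l /andP[ml _].
  by rewrite ltnNge ml /= altX.
rewrite -big_split; apply: eq_big_nat => l /andP[l0 lm] /=.
rewrite lm -altX -altM; congr (alt l _).
have l1 : l%:R != 0 :> rat by rewrite pnatr_eq0 -lt0n.
have ln : l%:R - n%:R != 0 :> rat by rewrite subr_eq0 eqr_nat; lia.
by field; rewrite l1.
Qed.

Lemma natr_doubleS (k : nat) : k.*2.+1%:R = 2 * k%:R + 1 :> rat.
Proof. by rewrite -natr1 -muln2 natrM mulrC. Qed.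

(** The factors at l = 2k+1 and l = 2k+2 multiply to (2k+1)/(2k+2) * (2(N-k)-1)/(2(N-k)), that is,
    c_(k+1)/c_k times c_(N-k)/c_(N-k-1). *)
Lemma prod_alt_cbin (N k : nat) : (k <= N)%N ->
  \prod_(1 <= l < k.*2.+1) alt l (1 - N.*2.+1%:R / l%:R) =
  cbin k * cbin N / cbin (N - k).
Proof.
elim: k => [|k IH] kN.
  by rewrite big_geq // cbin0 subn0 mul1r divff // cbin_neq0.
rewrite doubleS 2?big_nat_recr //= IH; last exact: ltnW.
rewrite /alt /= odd_double /=.
have -> : (N - k = (N - k.+1).+1)%N by lia.
have eN : N%:R = (N - k.+1)%:R + (k%:R + 1) :> rat by rewrite natr1 -natrD subnK.
have -> : N.*2.+1%:R = 2 * ((N - k.+1)%:R + k%:R + 1) + 1 :> rat.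
  by rewrite natr_doubleS eN; ring.
move: (N - k.+1)%N (cbin N) => j cN; rewrite !cbinS.
rewrite -[k.*2.+2%:R]natr1 natr_doubleS.
have cj := cbin_neq0 j.
have k0 : 0 <= k%:R :> rat by exact: ler0n.
have j0 : 0 <= j%:R :> rat by exact: ler0n.
have d1 : 2 * k%:R + 1 != 0 :> rat by apply: lt0r_neq0; lra.
field; rewrite ?cj; do ?[apply/andP; split].
all: try by apply: lt0r_neq0; lra.
  by [].
by apply: ltr0_neq0; lra.
Qed.

Lemma vterm_ratio (N i : nat) : (i < N)%N ->
  vterm N i.+1 = vterm N i * ((2 * i%:R + 1) / (2 * i%:R + 3))
    * ((2 * (N%:R - i%:R)) / (2 * (N%:R - i%:R) - 1))
    * ((2 * (N%:R + i%:R) + 3) / (2 * (N%:R + i%:R) + 4)).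
Proof.
move=> iN; have [j {iN}->] : exists j, N = (j + i.+1)%N.
  by exists (N - i.+1)%N; rewrite subnK.
have e : (j + i.+1 - i = j.+1)%N by rewrite addnS subSn ?leq_addl ?addnK.
rewrite /vterm addnK e [((j + i.+1).+1 + i.+1)%N]addnS addSn !cbinS.
have e2 : (j + i.+1 + i)%:R = j%:R + 2 * i%:R + 1 :> rat.
  by rewrite !natrD -natr1; ring.
have -> : (j + i.+1 + i).+1%:R = j%:R + 2 * i%:R + 2 :> rat by rewrite -natr1 e2; ring.
rewrite e2.
have -> : i.+1%:R = i%:R + 1 :> rat by rewrite natr1.
have -> : (j + i.+1)%:R = j%:R + i%:R + 1 :> rat by rewrite natrD -natr1 addrA.
have i0 : 0 <= i%:R :> rat by exact: ler0n.
have j0 : 0 <= j%:R :> rat by exact: ler0n.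
by field; do ?[apply/andP; split]; apply: lt0r_neq0; lra.
Qed.

(** Both sides have the same ratio between consecutive i. At i = 0 the product is c_N^4, by
    [prod_alt_cbin] with k = N. *)
Lemma vterm_wprod (N i : nat) : (i <= N)%N ->
  vterm N i = 2 * N.*2.+1%:R ^+ 3 / (i.*2.+1%:R * (N.*2.+1%:R + i.*2.+1%:R))
    * wprod N.*2.+1 i.*2.+1.
Proof.
move=> iN; rewrite wprod_split ?ltnS ?leq_double // prodrXl prod_alt_cbin //.
rewrite subnn cbin0 divr1.
have i0 : 0 <= i%:R :> rat by exact: ler0n.
have N0 : 0 <= N%:R :> rat by exact: ler0n.
elim: i iN i0 => [|i IH] iN i0.
  rewrite big_geq // /vterm subn0 addn0 cbinS !natr_doubleS.
  by field; do ?[apply/andP; split]; apply: lt0r_neq0; lra.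
have {}i0 : 0 <= i%:R :> rat by exact: ler0n.
have a1 x : alt i.*2.+1 x = x^-1 by rewrite /alt /= odd_double.
have a2 x : alt i.*2.+2 x = x by rewrite /alt /= odd_double.
rewrite vterm_ratio // doubleS (big_nat_recr i.*2.+2) // (big_nat_recr i.*2.+1) //.
rewrite IH ?(ltnW iN) // a1 a2.
move: (\big[_/_]_(1 <= l < i.*2.+1) _) (_ ^+ 2) => P Q.
have -> : i.*2.+3%:R = 2 * i%:R + 3 :> rat by rewrite -!natr1 -muln2 natrM; ring.
have -> : i.*2.+2%:R = 2 * i%:R + 2 :> rat by rewrite -!natr1 -muln2 natrM; ring.
rewrite !natr_doubleS.
have iN' : i%:R + 1 <= N%:R :> rat by rewrite natr1 ler_nat.
rewrite /=.
by field; do ?[apply/andP; split]; first [apply: lt0r_neq0; lra | apply: ltr0_neq0; lra].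
Qed.

Lemma big_odd_double (T : Type) (idx : T) (op : Monoid.law idx) (k : nat)
  (F : nat -> T) :
  \big[op/idx]_(0 <= m < k.*2 | odd m) F m =
  \big[op/idx]_(0 <= i < k) F i.*2.+1.
Proof.
elim: k => [|k IH]; first by rewrite !big_geq.
rewrite doubleS big_mkcond 2?big_nat_recr //= -big_mkcond IH odd_double /=.
by rewrite Monoid.mulm1 big_nat_recr.
Qed.

Definition oterm (n m : nat) : rat :=
  2 * n%:R ^+ 2 / (m%:R * (n%:R + m%:R)) * wprod n m.

Lemma S_oterm (n : nat) : odd n -> S n = \sum_(0 <= m < n.+1 | odd m) oterm n m.
Proof.
move=> no; have [N ->] : exists N, n = N.*2.+1.
  by exists n./2; rewrite -{1}[n]odd_double_half no.
rewrite /S /= doubleK -doubleS big_odd_double.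
rewrite (eq_bigr (fun k => (4 * k + 1)%:R * cbin k ^+ 4)); last first.
  by move=> k _; rewrite -mulrA -expr_div_n.
rewrite sum_cbin4 mulr_sumr; apply: eq_big_nat => i /andP[_ iN].
rewrite vterm_wprod // /oterm.
have N0 : N.*2.+1%:R != 0 :> rat by rewrite pnatr_eq0.
have i0 : i.*2.+1%:R != 0 :> rat by rewrite pnatr_eq0.
have Ni : N.*2.+1%:R + i.*2.+1%:R != 0 :> rat by rewrite -natrD pnatr_eq0.
move: N0 i0 Ni; move: N.*2.+1%:R i.*2.+1%:R (wprod _ _) => a b w a0 b0 ab.
by field; rewrite a0 b0 ab.
Qed.

(** * Comparison modulo p^4 *)

Lemma onemod_subr (p k : nat) (x : rat) :
  prime p -> pint p (x / p%:R ^+ k) -> onemod p k (1 - x).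
Proof. by move=> pp px; rewrite /onemod addrAC subrr sub0r mulNr pintN. Qed.

(** The two denominators are l(l'+p) and (l+p)l', whose difference is a multiple of p; the numerator
    nm supplies p^3. *)
Lemma onemod_shift (p n m l l' : nat) :
  prime p -> (p %| m)%N -> (p ^ 2 %| n)%N -> (n + m = l + (l' + p))%N ->
  ~~ (p %| l)%N ->
  onemod p 4 ((1 - n%:R * m%:R / (l%:R * (n%:R + m%:R - l%:R)))
    / (1 - n%:R * m%:R / ((l + p)%:R * (n%:R + m%:R - (l + p)%:R)))).
Proof.
move=> pp /dvdnP[mu mE] /dvdnP[nu nE] nm pl.
have eA : n%:R + m%:R - l%:R = (l' + p)%:R :> rat.
  by rewrite -natrD nm natrD addrAC subrr add0r.
have eB : n%:R + m%:R - (l + p)%:R = l'%:R :> rat.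
  by rewrite -natrD nm !natrD; ring.
rewrite eA eB.
have pl' : ~~ (p %| l')%N.
  apply: contra pl => pl'; rewrite -(dvdn_addl _ (dvdn_add pl' (dvdnn p))) -nm.
  by rewrite mE nE dvdn_add ?dvdn_mull // expnS dvdn_mulr.
have plp : ~~ (p %| l + p)%N by rewrite dvdn_addl.
have plp' : ~~ (p %| l' + p)%N by rewrite dvdn_addl.
have nz k : ~~ (p %| k)%N -> k%:R != 0 :> rat.
  by rewrite pnatr_eq0; apply: contraNneq => ->.
have p0 : p%:R != 0 :> rat by rewrite pnatr_eq0 -lt0n prime_gt0.
set X := 1 - n%:R * m%:R / ((l + p)%:R * l'%:R).
(* X is 1 mod p, so dividing by it keeps p-integrality. *)
have oX : onemod p 1 X.
  apply: onemod_subr => //.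
  have -> : n%:R * m%:R / ((l + p)%:R * l'%:R) / p%:R ^+ 1 =
    (nu * p * m)%:R * (l + p)%:R^-1 * l'%:R^-1 :> rat.
    rewrite nE !natrM; field; rewrite p0 nz //=.
    by rewrite -natrD nz.
  by rewrite !pintM ?pint_nat ?pint_natV.
have [X0 pX] := onemod_unit pp oX.
have -> : (1 - n%:R * m%:R / (l%:R * (l' + p)%:R)) / X =
  1 - p%:R ^+ 4 * ((nu * mu)%:R * (l'%:R - l%:R) * l%:R^-1 * l'%:R^-1
        * (l + p)%:R^-1 * (l' + p)%:R^-1 * X^-1).
  apply: (mulIf X0); rewrite divfK // mulrBl mul1r -!mulrA mulVf // mulr1.
  rewrite /X nE mE !natrM !natrD; field.
  by rewrite -!natrD !nz.
apply: onemod_subr => //; rewrite mulrAC divff ?expf_neq0 // mul1r.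
by rewrite !pintM ?pint_natV ?pint_nat ?pintD ?pintN ?pint_nat.
Qed.

(** One of the two copies of 1 - n/l is reflected by l -> n+m-l, which preserves parity because n+m
    is even. Then (1 - n/l)(1 - n/(n+m-l)) = 1 - nm/(l(n+m-l)). *)
Lemma prod_reflect (p nu mu : nat) (n := (p * nu)%N) (m := (p * mu)%N) :
  (0 < p)%N -> odd nu -> odd mu -> (mu <= nu)%N ->
  \prod_(m <= l < n | ~~ (p %| l)%N) alt l ((1 - n%:R / l%:R) ^+ 2) =
  \prod_(m <= l < n | ~~ (p %| l)%N)
     alt l (1 - n%:R * m%:R / (l%:R * (n%:R + m%:R - l%:R))).
Proof.
move=> p0 onu omu mn.
have [->|mn'] := eqVneq m n; first by rewrite !big_geq.
have lt_mn : (m < n)%N by rewrite ltn_neqAle mn' leq_mul2l mn orbT.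
(* The index m is a multiple of p; without it the range is symmetric under the reflection. *)
have drop (F : nat -> rat) : \prod_(m <= l < n | ~~ (p %| l)%N) F l
    = \prod_(m.+1 <= l < n | ~~ (p %| l)%N) F l.
  by rewrite big_ltn_cond // dvdn_mulr.
rewrite !drop.
under eq_bigr => l _ do rewrite altX expr2.
rewrite big_split /= [X in _ * X]big_nat_rev.
rewrite [X in _ * X](congr_big_nat m.+1 n (fun l => ~~ (p %| l)%N)
  (fun l => alt l (1 - n%:R / (n%:R + m%:R - l%:R)))) //; last 2 first.
- move=> l /andP[lm ln]; rewrite addSn subSS dvdn_subr //.
    by rewrite (leq_trans (ltnW ln)) ?leq_addl.
  by rewrite dvdn_add ?dvdn_mulr.
- move=> l /and3P[_ lm ln].
  have lmn : (l <= m + n)%N by rewrite (leq_trans (ltnW ln)) ?leq_addl.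
  rewrite addSn subSS natrB // natrD [m%:R + _]addrC /alt oddB // oddD !oddM.
  by rewrite onu omu addbb.
rewrite -big_split; apply: congr_big_nat => // l /and3P[_ lm ln] /=.
rewrite -altM; congr (alt l _).
have l0 : l%:R != 0 :> rat by rewrite pnatr_eq0; lia.
have nml : n%:R + m%:R - l%:R != 0 :> rat.
  by rewrite -natrD subr_eq0 eqr_nat; lia.
by field; rewrite l0 nml.
Qed.

Lemma wprod_pmul (p nu mu : nat) : prime p -> odd p -> (p %| nu)%N ->
  odd nu -> odd mu -> (mu <= nu)%N ->
  exists2 u, onemod p 4 u & wprod (p * nu) (p * mu) = wprod nu mu * u.
Proof.
move=> pp op pnu onu omu mn.
have p0 := prime_gt0 pp; have nu0 : (0 < nu)%N by case: (nu) onu.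
pose F n m l : rat :=
  alt l (if (l < m)%N then 1 - (n%:R / l%:R) ^+ 2 else (1 - n%:R / l%:R) ^+ 2).
have W0 n m : (0 < n)%N -> wprod n m = \prod_(0 <= l < n) F n m l.
  (* The factor at l = 0 is 1, as n / 0 = 0. *)
  move=> n0; rewrite [RHS]big_ltn // /F /alt /= invr0 mulr0.
  by case: ifP => _; rewrite ?expr0n subr0 ?expr1n mul1r.
rewrite !W0 ?muln_gt0 ?p0 //.
rewrite (bigID (fun l => p %| l)%N) /=.
under eq_bigl => l do rewrite -[(p %| l)%N]andbT.
rewrite big_dvdn //=.
exists (\prod_(0 <= l < p * nu | ~~ (p %| l)%N) F (p * nu)%N (p * mu)%N l); last first.
  (* The index p l has the parity of l, and the quotient (p nu)/(p l) equals nu/l. *)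
  congr (_ * _); apply: eq_big_nat => l _.
  have pR : p%:R != 0 :> rat by rewrite pnatr_eq0 -lt0n.
  rewrite /F ltn_pmul2l // /alt oddM op /= !natrM -mulf_div divff // mul1r //.
have mn' : (p * mu <= p * nu)%N by rewrite leq_mul2l mn orbT.
rewrite (big_cat_nat (leq0n _) mn') /=; apply: onemodM => //.
  apply: onemod_prod => // l; rewrite mem_index_iota => /andP[_ lm] pl.
  rewrite /F lm; apply: onemod_alt => //; apply: onemod_subr => //.
  have [k ->] := dvdnP pnu.
  have -> : ((p * (k * p))%:R / l%:R) ^+ 2 / p%:R ^+ 4 = (k%:R * l%:R^-1) ^+ 2 :> rat.
    have pR : p%:R != 0 :> rat by rewrite pnatr_eq0 -lt0n.
    have l0 : l%:R != 0 :> rat by rewrite pnatr_eq0; apply: contraNneq pl => ->.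
    by rewrite !natrM; field; rewrite pR l0.
  by rewrite pintX // pintM ?pint_nat ?pint_natV.
rewrite (congr_big_nat (p * mu) (p * nu) (fun l => ~~ (p %| l)%N)
  (fun l => alt l ((1 - (p * nu)%:R / l%:R) ^+ 2))) //; last first.
  by move=> l /and3P[_ ml _]; rewrite /F ltnNge ml.
rewrite prod_reflect //.
(* Both nu and mu are odd, so the number of blocks is even. *)
have e : nu = (mu + (nu - mu)./2.*2)%N.
  by rewrite halfK oddB // onu omu /= subn0 subnKC.
rewrite [in X in index_iota _ X]e.
apply: onemod_alt_blocks => // l ml; rewrite -e => ln pl.
apply: (@onemod_shift _ _ _ _ (p * nu + p * mu - l - p)) => //.
- by rewrite dvdn_mulr.
- by rewrite expnS expn1 dvdn_pmul2l.
- lia.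
Qed.

(** For s > 0 each quotient p^s / l is p times a p-integral number by [pint_divp], so every factor
    is 1 mod p; for s = 0 the product is empty. *)
Lemma wprod_pint (p s m : nat) : prime p -> pint p (wprod (p ^ s) m).
Proof.
move=> pp; apply: (@onemod_pint _ 1) => //.
apply: onemod_prod => // l; rewrite mem_index_iota => /andP[l0 ln] _.
case: s ln => [|s] ln; first by rewrite expn0 ltnNge l0 in ln.
have pR : p%:R != 0 :> rat by rewrite pnatr_eq0 -lt0n prime_gt0.
have px : pint p ((p ^ s)%:R / l%:R) by rewrite pint_divp // l0.
have e : (p ^ s.+1)%:R / l%:R / p%:R ^+ 1 = (p ^ s)%:R / l%:R :> rat.
  by rewrite expnS natrM mulrAC expr1 [p%:R * _]mulrC mulfK.
have o1 : onemod p 1 (1 - (p ^ s.+1)%:R / l%:R).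
  by apply: onemod_subr => //; rewrite e.
apply: onemod_alt => //; case: ifP => _; last by rewrite expr2 onemodM.
apply: onemod_subr => //; rewrite expr2 -[_ / _ ^+ 1]mulrA e pintM //.
by rewrite expnS natrM -mulrA pintM // pint_nat.
Qed.

Lemma S_step (p s : nat) : prime p -> odd p -> (0 < s)%N ->
  rat_congr p 4 (S (p ^ s.+1)) (S (p ^ s)).
Proof.
move=> pp op s0; have p0 := prime_gt0 pp.
have pR : p%:R != 0 :> rat by rewrite pnatr_eq0 -lt0n.
have osn : odd (p ^ s) by rewrite oddX op orbT.
rewrite /rat_congr -/(pint p _) !S_oterm //; last by rewrite oddX op orbT.
rewrite (bigID (fun l => p %| l)%N) /=.
under eq_bigl => l do rewrite andbC.
rewrite [in X in X + _]expnS big_dvdnS //.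
under eq_bigl => l do rewrite oddM op.
rewrite addrAC -sumrB mulrDl !mulr_suml; apply: pintD => //.
  apply: pint_sum => // m; rewrite mem_index_iota ltnS /= => mn om.
  have m0 : (0 < m)%N by case: (m) om.
  have [u ou Wu] := wprod_pmul pp op (dvdn_exp s0 (dvdnn p)) osn om mn.
  have -> : (oterm (p * p ^ s) (p * m) - oterm (p ^ s) m) / p%:R ^+ 4 =
      2 * ((p ^ s)%:R / m%:R) * ((p ^ s)%:R / (p ^ s + m)%:R) * wprod (p ^ s) m
        * ((u - 1) / p%:R ^+ 4).
    rewrite /oterm Wu !natrM natrD; field.
    have mR : m%:R != 0 :> rat by rewrite pnatr_eq0 -lt0n.
    have smR : (p ^ s)%:R + m%:R != 0 :> rat.
      by rewrite -natrD pnatr_eq0 addn_eq0 negb_and -!lt0n m0 orbT.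
    by rewrite pR smR mR -mulrDr mulf_neq0.
  (* As p > 2, both m and p^s + m lie below p^(s+1), so [pint_divp] applies to both denominators. *)
  have small k : (k <= 2 * p ^ s)%N -> (k < p ^ s.+1)%N.
    move=> k2; rewrite expnS (leq_ltn_trans k2) // ltn_pmul2r ?expn_gt0 ?p0 //.
    by rewrite odd_prime_gt2.
  have pdiv k : (0 < k)%N -> (k <= 2 * p ^ s)%N -> pint p ((p ^ s)%:R / k%:R).
    by move=> k0 k2; rewrite pint_divp // k0 small.
  apply: pintM => //; apply: pintM => //; last exact: wprod_pint.
  apply: pintM => //; last by apply: pdiv; lia.
  by apply: pintM => //; [exact: pint_nat | apply: pdiv; lia].
apply: pint_sum => // m _ /andP[_ pm].
have pnm : ~~ (p %| p * p ^ s + m)%N by rewrite dvdn_addr // dvdn_mulr.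
(* As s > 0, the square of p^(s+1) absorbs p^4 and leaves the square of p^(s-1). *)
have -> : oterm (p * p ^ s) m / p%:R ^+ 4 = 2 * ((p ^ s.-1)%:R ^+ 2) * m%:R^-1
    * (p * p ^ s + m)%:R^-1 * wprod (p ^ s.+1) m.
  case: s s0 pnm {osn} => // s _ pnm; rewrite /oterm -expnS natrD !expnS !natrM.
  have nz k : ~~ (p %| k)%N -> k%:R != 0 :> rat.
    by rewrite pnatr_eq0; apply: contraNneq => ->.
  by field; rewrite pR (nz _ pm) -!natrM -natrD -expnS nz.
by rewrite !pintM ?wprod_pint ?pintX ?pint_nat ?pint_natV.
Qed.

Theorem theorem3p1 (p r : nat) :
  prime p -> odd p -> (0 < r)%N ->
  rat_congr p 4 (S (p ^ r)) (S p).
Proof.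
move=> pp op; case: r => // r _; elim: r => [|r IH].
  by rewrite expn1 /rat_congr subrr mul0r -/(pint p 0) (pint_nat 0).
have := pintD pp (S_step pp op (ltn0Sn r)) IH.
by rewrite -mulrDl addrA subrK.
Qed.
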